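(* Let $\sigma\in\mathfrak{S}_n$, $\tau\in\mathfrak{S}_m$, $0<\epsilon\leq(2m)^{-1}$, and let $\{C_j\}_{j=0}^k$ be an $(\epsilon,\mathcal{F})$-uniform partition of $\sigma$, where $n$ is sufficiently large (in terms of $m$, $\epsilon$ and $k$). If $\Lambda^\tau(\sigma) < \left(\frac{\epsilon n}{2km}\right)^m$, then for each $1\leq s\leq k$ there is a collection $\mathcal{I}$ of at most $m-1$ disjoint intervals in $[0,1)$, each of length at most $6\epsilon$, such that $$\left|\sigma(C_s)\cap \left(n\cdot\bigcup\mathcal{I}\right)\right| \geq |C_s|(1-7m\epsilon).$$
   Context: $\mathfrak{S}_n$ is the set of permutations of $\mathbb{Z}_n$, where $\mathbb{Z}_n$ is identified with $\{0,1,\ldots,n-1\}$ with its usual linear order; an interval of $\mathbb{Z}_n$ is a set of consecutive integers in it. For $X\subset[0,1)$, $n\cdot X=\{nx:x\in X\}$, and $\bigcup\mathcal{I}$ is the union of the members of $\mathcal{I}$. For $\tau\in\mathfrak{S}_m$ and $\sigma\in\mathfrak{S}_n$, $\Lambda^\tau(\sigma)$ is the number of sets $\{x_0<\cdots<x_{m-1}\}\subset\mathbb{Z}_n$ such that for all $i,j$: $\sigma(x_i)<\sigma(x_j)$ iff $\tau(i)<\tau(j)$. A partition $\{C_j\}_{j=0}^k$ of $\sigma$ means a partition of $\mathbb{Z}_n$ with a designated exceptional set $C_0$ (possibly empty, not necessarily an interval) and in which each $C_j$, $1\le j\le k$, is a nonempty interval. It is equitable if $|C_s|=|C_t|$ for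 all $1\le s,t\le k$. For nonempty $S\subset \mathbb{Z}_n$ and $\alpha\in[0,1]$, let $\mathcal{L}(S,\alpha) = |\sigma(S)\cap[0,\alpha n)|/|S|$. A function $f:[0,1]\to[0,1]$ is $\epsilon$-near $g:[0,1]\to[0,1]$ if for each $\alpha\in[0,1]$, $g(\alpha-\epsilon)-\epsilon\leq f(\alpha)\leq g(\alpha+\epsilon)+\epsilon$, with the convention $g(\alpha)=g(0)$ for $\alpha<0$ and $g(\alpha)=g(1)$ for $\alpha>1$. A partition $\{C_j\}_{j=0}^k$ of $\sigma$ is $(\epsilon,\mathcal{F})$-uniform, where $\mathcal{F}=\{f_s\}_{s=1}^k$ is a family of functions $[0,1]\to[0,1]$, if it is equitable, $|C_0|\leq\epsilon n$, and for each $s\in\{1,\ldots,k\}$ and every interval $I\subset C_s$ with $|I|\geq\epsilon|C_s|$, the function $\mathcal{L}(I,\cdot)$ is $\epsilon$-near $f_s$. *)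

(* Defs.v *)
From HB Require Import structures.
From mathcomp Require Import all_boot all_order all_fingroup all_algebra.
From mathcomp Require Import all_classical all_reals all_analysis.

Set Implicit Arguments.
Unset Strict Implicit.
Unset Printing Implicit Defensive.

Import Order.TTheory GRing.Theory Num.Theory.

Local Open Scope ring_scope.

Definition pattern_count (m n : nat) (tau : 'S_m) (sigma : 'S_n) : nat :=
  #|[set X : {set 'I_n} | [exists x : {ffun 'I_m -> 'I_n},
      [&& X == [set x i | i in 'I_m],
          [forall i : 'I_m, forall j : 'I_m, (i < j)%N ==> (x i < x j)%N]
        & [forall i : 'I_m, forall j : 'I_m,
             (sigma (x i) < sigma (x j))%N == (tau i < tau j)%N]]]]|.

Definition is_ord_interval (n : nat) (S : {set 'I_n}) : Prop :=
  exists a b : nat, S = [set x : 'I_n | (a <= x < b)%N].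

Definition value_cdf (R : realType) (n : nat) (sigma : 'S_n)
    (S : {set 'I_n}) (alpha : R) : R :=
  #|[set y in sigma @: S | (y : nat)%:R \in `[0, alpha * n%:R[]|%:R
    / #|S|%:R.

(* A function [0,1] -> [0,1] is a total function R -> R satisfying set_fun on
   the unit interval; its values outside [0,1] are never used. *)
Definition extend01 (R : realType) (g : R -> R) (alpha : R) : R :=
  if alpha < 0 then g 0 else if 1 < alpha then g 1 else g alpha.

Definition eps_near (R : realType) (eps : R) (f g : R -> R) : Prop :=
  forall alpha : R, 0 <= alpha <= 1 ->
    extend01 g (alpha - eps) - eps <= f alpha <= extend01 g (alpha + eps) + eps.

(* C0 is the exceptional class; C s, for s < k, is the class usually numbered
   s + 1.  MathComp's partition predicate does not apply: C0 may be empty. *)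
Definition is_perm_partition (n k : nat) (C0 : {set 'I_n})
    (C : 'I_k -> {set 'I_n}) : Prop :=
  [/\ C0 :|: \bigcup_(s < k) C s = [set: 'I_n],
      forall s, [disjoint C0 & C s],
      forall s t, s != t -> [disjoint C s & C t],
      forall s, C s != finset.set0
    & forall s, is_ord_interval (C s)].

Definition equitable (n k : nat) (C : 'I_k -> {set 'I_n}) : Prop :=
  forall s t, #|C s| = #|C t|.

Definition is_uniform_partition (R : realType) (n k : nat) (sigma : 'S_n)
    (C0 : {set 'I_n}) (C : 'I_k -> {set 'I_n})
    (eps : R) (F : 'I_k -> R -> R) : Prop :=
  [/\ is_perm_partition C0 C,
      forall s, set_fun `[0, 1]%classic `[0, 1]%classic (F s),
      equitable C,
      #|C0|%:R <= eps * n%:R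
    & forall (s : 'I_k) (I : {set 'I_n}), is_ord_interval I ->
        I \subset C s -> eps * #|C s|%:R <= #|I|%:R ->
        eps_near eps (value_cdf sigma I) (F s)].

Definition dilate (R : realType) (n : nat) (X : set R) : set R :=
  [set n%:R * x | x in X]%classic.

(* Main.v *)
(** Cut [C s] into [m] consecutive intervals of equal length; each has, up to an
    error [2 eps] in both argument and value, the same value distribution as
    [C s].  Sweep the values of [C s] upwards, closing a slab as soon as it has
    captured a fraction [5 eps] of [C s] and then skipping a gap of width
    [4 eps].  If [m] slabs get closed, widening them by [2 eps] on both sides
    keeps them disjoint, and each piece of [C s] sends a fraction at least [eps]
    of its points into each widened slab; sending the [i]-th piece into the
    [tau i]-th slab yields too many copies of [tau].  Otherwise the at most
    [m - 1] gaps miss only the slabs, i.e. about [5 m eps] of [C s]. *)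

Require Import Defs.
From HB Require Import structures.
From mathcomp Require Import all_boot all_order all_fingroup all_algebra.
From mathcomp Require Import all_classical all_reals all_analysis.
From mathcomp Require Import ring lra zify.

Set Implicit Arguments.
Unset Strict Implicit.
Unset Printing Implicit Defensive.

Import Order.TTheory GRing.Theory Num.Theory.

Local Open Scope ring_scope.

(** * Sweeping a set of values into dense slabs and gaps *)

Definition slab (R : realType) (n : nat) (A : {set 'I_n}) (a b : R) : {set 'I_n} :=
  [set y in A | a <= (y : nat)%:R / n%:R < b].

(** Only the value [t] can have its quotient by [n] in the added strip, so a slab closed at the
    first multiple of [1/n] where it is full overshoots by at most one. *)
Lemma slab_natSr (R : realType) (n : nat) (A : {set 'I_n}) (a : R) (t : nat) :
  (#|slab A a (t.+1%:R / n%:R)| <= #|slab A a (t%:R / n%:R)|.+1)%N.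
Proof.
case: (posnP n) => [n0|n_gt0].
  by rewrite (leq_trans (max_card _)) // card_ord (leq_trans _ (leq0n _)) // n0.
have n_gt0R : 0 < n%:R :> R by rewrite ltr0n.
case: (ltnP t n) => [ltn|len].
  rewrite -[X in (_ <= X)%N]add1n -(cards1 (Ordinal ltn)).
  apply: leq_trans (leq_card_setU _ _); apply: subset_leq_card.
  apply/fintype.subsetP => y; rewrite !inE => /andP[-> /andP[-> ]] /=.
  rewrite !ltr_pM2r ?invr_gt0// !ltr_nat ltnS leq_eqVlt -val_eqE /=.
  by case/orP => ->; rewrite ?orbT.
apply: leqW; apply: subset_leq_card.
apply/fintype.subsetP => y; rewrite !inE => /andP[-> /andP[-> _]] /=.
by rewrite ltr_pM2r ?invr_gt0// ltr_nat (leq_trans (ltn_ord y)).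
Qed.

(** Induction on [m], with the starting height [a] left free so that the sweep can resume at
    [b + g]. In the second alternative the [p i] are the closing heights of the [r] completed slabs;
    what the gaps miss lies in [r + 1 <= m] slabs, each with at most [M + 1] values. *)
Lemma slabs_or_gaps (R : realType) (n : nat) (A : {set 'I_n}) (M g : R) (m : nat) :
  (0 < n)%N -> 0 < M -> 0 <= g -> forall a : R,
  (exists l u : nat -> R,
    [/\ forall i, (i < m)%N -> a <= l i,
        forall i j, (i < j < m)%N -> u i + g <= l j
      & forall i, (i < m)%N -> M <= #|slab A (l i) (u i)|%:R]) \/
  (exists (r : nat) (p : nat -> R),
    [/\ (r < m)%N,
        forall i, (i < r)%N -> a <= p i,
        forall i j, (i < j < r)%N -> p i + g <= p j
      & #|[set y in A | (a <= (y : nat)%:R / n%:R) &&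
            [forall i : 'I_r, ~~ (p i <= (y : nat)%:R / n%:R < p i + g)]]|%:R
          <= m%:R * (M + 1)]).
Proof.
move=> n_gt0 M_gt0 g_ge0; have n_gt0R : 0 < n%:R :> R by rewrite ltr0n.
elim: m => [|m IHm] a.
  by left; exists (fun=> a), (fun=> a); split=> // i j; rewrite andbF.
pose full := fun t : nat => M <= #|slab A a (t%:R / n%:R)|%:R.
have [exT|] := pselect (exists t, full t); last first.
  (* At [t = n] the slab holds every value from [a] upwards, so fewer than [M] values remain and no
     gap is opened. *)
  move/forallNP => /(_ n) /negP; rewrite /full -ltNge => lowM.
  right; exists 0%N, (fun=> a); split=> // [i j|]; first by rewrite andbF.
  apply: (@le_trans _ _ M); last first.
    have : 0 <= m%:R * (M + 1) by rewrite mulr_ge0 ?ler0n // addr_ge0 ?ltW.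
    by rewrite -natr1 (mulrDl m%:R); lra.
  apply: le_trans (ltW lowM); rewrite ler_nat; apply: subset_leq_card.
  apply/fintype.subsetP => y; rewrite !inE => /andP[-> /andP[-> _]] /=.
  by rewrite ltr_pM2r ?invr_gt0// ltr_nat.
case: (ex_minnP exT) => -[|t] fullt mint.
  (* The least full [t] is positive, so that [t - 1] is available and not full: normalised values
     are nonnegative and a slab ending at 0 is empty. *)
  have slab0 : #|slab A a 0| = 0%N.
    apply/eqP; rewrite cards_eq0; apply/eqP/setP => y; rewrite !inE.
    by rewrite [_ < 0]ltNge divr_ge0 ?ler0n // !andbF.
  move: fullt; rewrite /full mulr0n mul0r slab0 => /(lt_le_trans M_gt0).
  by rewrite ltxx.
pose b : R := t.+1%:R / n%:R.
have lowt : #|slab A a b|%:R <= M + 1.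
  have : #|slab A a (t%:R / n%:R)|%:R < M.
    rewrite ltNge; apply/negP => /mint; by rewrite ltnn.
  have : #|slab A a b|%:R <= #|slab A a (t%:R / n%:R)|.+1%:R :> R.
    by rewrite ler_nat slab_natSr.
  rewrite -natr1; lra.
have leab : a <= b.
  have : (0 < #|slab A a b|)%N by rewrite -(ltr0n R) (lt_le_trans M_gt0).
  case/card_gt0P => y; rewrite inE => /andP[_ /andP[? ?]]; lra.
case: (IHm (b + g)) => [[l [u [al sep ml]]]|[r [p [rm ap sep cov]]]].
  left; exists (fun i => if i is i'.+1 then l i' else a),
               (fun i => if i is i'.+1 then u i' else b); split.
  - case=> [//|i /al]; lra.
  - case=> [|i] [|j] //; first by move=> ?; apply: al.
    exact: sep.
  - by case=> [//|i /ml].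
right; exists r.+1, (fun i => if i is i'.+1 then p i' else b); split=> //.
- case=> [//|i /ap]; lra.
- case=> [|i] [|j] //; first by move=> ?; apply: ap.
  exact: sep.
- have -> : m.+1%:R * (M + 1) = (M + 1) + m%:R * (M + 1) by rewrite -natr1; ring.
  apply: le_trans (lerD lowt cov); rewrite -natrD ler_nat.
  apply: leq_trans (leq_card_setU _ _); apply: subset_leq_card.
  apply/fintype.subsetP => y; rewrite !inE => /andP[-> /andP[-> /forallP Hy]] /=.
  case: ltP => //= by_; have := Hy ord0; rewrite /= by_ /= -leNgt => -> /=.
  by apply/forallP => i; have := Hy (lift ord0 i); rewrite /= /bump.
Qed.

(** Any choice of one point from each [S i] is a copy of [tau]. Distinct choices give distinct sets,
    since the [S i] are separated in position and a point therefore determines its index. *)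
Lemma pattern_count_ge (m n : nat) (tau : 'S_m) (sigma : 'S_n) (S : 'I_m -> {set 'I_n}) :
  (forall (i j : 'I_m) x y, (i < j)%N -> x \in S i -> y \in S j -> (x < y)%N) ->
  (forall (i j : 'I_m) x y, (tau i < tau j)%N -> x \in S i -> y \in S j ->
     (sigma x < sigma y)%N) ->
  (\prod_i #|S i| <= pattern_count tau sigma)%N.
Proof.
move=> incS incV.
pose D := [set x : {ffun 'I_m -> 'I_n} | x \in family (fun i => mem (S i))].
have DP x : x \in D -> forall i, x i \in S i by rewrite inE => /familyP.
have <- : #|D| = (\prod_i #|S i|)%N.
  by rewrite cardsE card_family foldrE big_map big_enum.
pose f (x : {ffun 'I_m -> 'I_n}) := [set x i | i in 'I_m].
have injf : {in D &, injective f}.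
  move=> x y /DP Dx /DP Dy fxy; apply/ffunP => i.
  have : x i \in f y by rewrite -fxy imset_f.
  case/imsetP => j _ xyij; rewrite xyij; congr (y _); apply: val_inj => /=.
  case: (ltngtP i j) => // ij.
    by have := incS _ _ _ _ ij (Dx i) (Dy j); rewrite xyij ltnn.
  by have := incS _ _ _ _ ij (Dy j) (Dx i); rewrite xyij ltnn.
rewrite -(card_in_imset injf); apply: subset_leq_card.
apply/fintype.subsetP => X /imsetP[x /DP Dx ->]; rewrite inE.
apply/existsP; exists x; rewrite eqxx /=; apply/andP; split.
  by apply/forallP => i; apply/forallP => j; apply/implyP => ij; apply: (incS i j).
apply/forallP => i; apply/forallP => j.
case: (ltngtP (tau i) (tau j)) => [ij|ji|/val_inj/perm_inj ->].
- by rewrite (incV i j).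
- by rewrite ltnNge (ltnW (incV j i _ _ ji _ _)).
- by rewrite ltnn.
Qed.

(** * Comparing the value distributions of two sets near a common function *)

Lemma leq_card_slab_split (R : realType) (n : nat) (A : {set 'I_n}) (a b c : R) :
  (#|slab A a c| <= #|slab A a b| + #|slab A b c|)%N.
Proof.
apply: leq_trans (leq_card_setU _ _); apply: subset_leq_card.
apply/fintype.subsetP => y; rewrite !inE => /andP[-> /andP[-> ->]] /=.
by rewrite andbT; case: leP.
Qed.

Lemma card_slab_split (R : realType) (n : nat) (A : {set 'I_n}) (a b c : R) :
  a <= b -> b <= c -> (#|slab A a b| + #|slab A b c| <= #|slab A a c|)%N.
Proof.
move=> ab bc; rewrite -[X in (X <= _)%N]subn0.
have <- : #|slab A a b :&: slab A b c| = 0%N.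
  apply/eqP; rewrite cards_eq0; apply/eqP/setP => y; rewrite !inE.
  by case: ltP => //; rewrite !andbF.
rewrite -cardsU; apply: subset_leq_card; apply/fintype.subsetP => y; rewrite !inE.
case/orP => /andP[-> /andP[? ?]] /=; apply/andP; split; lra.
Qed.

Lemma value_cdfE (R : realType) (n : nat) (sigma : 'S_n) (S : {set 'I_n}) (x : R) :
  (0 < n)%N -> value_cdf sigma S x = #|slab (sigma @: S) 0 x|%:R / #|S|%:R.
Proof.
move=> n_gt0; rewrite /value_cdf; congr (_%:R / _); apply: eq_card => y.
rewrite [LHS]inE [RHS]inE in_itv /= ler0n divr_ge0 ?ler0n //=.
by rewrite ltr_pdivrMr ?ltr0n.
Qed.

(* Outside [0, 1] the conclusion holds because [value_cdf] is total: it is [0] at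
   negative arguments and [1] beyond [1]. *)
Lemma value_cdf_near_shift (R : realType) (n : nat) (sigma : 'S_n)
    (S T : {set 'I_n}) (eps : R) (g : R -> R) :
  (0 < n)%N -> (0 < #|T|)%N -> 0 <= eps ->
  eps_near eps (value_cdf sigma S) g -> eps_near eps (value_cdf sigma T) g ->
  forall x, value_cdf sigma S x <= value_cdf sigma T (x + 2 * eps) + 2 * eps.
Proof.
move=> n_gt0 T_gt0 eps_ge0 nearS nearT x.
have n_gt0R : 0 < n%:R :> R by rewrite ltr0n.
have cdf_ge0 U y : 0 <= value_cdf sigma U y by rewrite divr_ge0 ?ler0n.
have [x_lt0|x_ge0] := ltP x 0.
  rewrite value_cdfE // (_ : slab _ 0 x = finset.set0) ?cards0 ?mul0r.
    by rewrite addr_ge0 ?cdf_ge0 ?mulr_ge0.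
  apply/setP => y; rewrite !inE; apply/negP => /andP[_ /andP[? ?]]; lra.
have [x_gt1|x_le1] := ltP 1 (x + 2 * eps).
  have -> : value_cdf sigma T (x + 2 * eps) = 1.
    rewrite value_cdfE // (_ : slab _ _ _ = sigma @: T).
      by rewrite card_imset ?divff ?pnatr_eq0 ?lt0n_neq0 //; apply: perm_inj.
    apply/setP => y; rewrite !inE divr_ge0 ?ler0n //= andb_idr // => _.
    rewrite (lt_trans _ x_gt1) // ltr_pdivrMr // mul1r ltr_nat; exact: ltn_ord.
  have : value_cdf sigma S x <= 1.
    rewrite value_cdfE //; have [->|S_gt0] := posnP #|S|.
      by rewrite invr0 mulr0.
    rewrite ler_pdivrMr ?ltr0n // mul1r ler_nat.
    apply: leq_trans (leq_imset_card sigma _); apply: subset_leq_card.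
    by apply/fintype.subsetP => y; rewrite inE => /andP[].
  lra.
(* Both estimates meet at [g (x + eps)]: nearness of [S] at [x] bounds from above, nearness of [T]
   at [x + 2 * eps] from below, each at the cost of [eps]. *)
have /nearS/andP[_] : 0 <= x <= 1 by apply/andP; split; lra.
have /nearT/andP[] : 0 <= x + 2 * eps <= 1 by apply/andP; split; lra.
have -> : x + 2 * eps - eps = x + eps by ring.
lra.
Qed.

(** The distribution of [T] rises by [5 * eps] across the slab; passing to [S] loses [2 * eps] at
    each end and leaves [eps]. *)
Lemma slab_density_transfer (R : realType) (n : nat) (sigma : 'S_n)
    (S T : {set 'I_n}) (eps : R) (g : R -> R) (a b : R) :
  (0 < n)%N -> (0 < #|S|)%N -> (0 < #|T|)%N -> 0 < eps -> 0 <= a ->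
  eps_near eps (value_cdf sigma S) g -> eps_near eps (value_cdf sigma T) g ->
  5 * eps * #|T|%:R <= #|slab (sigma @: T) a b|%:R ->
  eps * #|S|%:R <= #|slab (sigma @: S) (a - 2 * eps) (b + 2 * eps)|%:R.
Proof.
move=> n_gt0 S_gt0 T_gt0 eps_gt0 a_ge0 nearS nearT dense.
have S_gt0R : 0 < #|S|%:R :> R by rewrite ltr0n.
have T_gt0R : 0 < #|T|%:R :> R by rewrite ltr0n.
have le_ab : a <= b.
  have : (0 < #|slab (sigma @: T) a b|)%N.
    by rewrite -(ltr0n R) (lt_le_trans _ dense) // !mulr_gt0.
  case/card_gt0P => y; rewrite inE => /andP[_ /andP[? ?]]; lra.
have incr : 5 * eps <= value_cdf sigma T b - value_cdf sigma T a.
  rewrite !value_cdfE // -mulrBl ler_pdivlMr // (le_trans dense) //.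
  by rewrite lerBrDl -natrD ler_nat card_slab_split.
have lowb := value_cdf_near_shift n_gt0 S_gt0 (ltW eps_gt0) nearT nearS b.
have := value_cdf_near_shift n_gt0 T_gt0 (ltW eps_gt0) nearS nearT (a - 2 * eps).
rewrite subrK => lowa.
have : eps <= value_cdf sigma S (b + 2 * eps) - value_cdf sigma S (a - 2 * eps).
  lra.
rewrite !value_cdfE // -mulrBl ler_pdivlMr // => /le_trans; apply.
(* Since [a - 2 * eps] may be negative, the split used here is the one valid for any order of the
   endpoints. *)
by rewrite lerBlDl -natrD ler_nat leq_card_slab_split.
Qed.

(** * Intervals of positions and the sizes of the classes *)

Lemma card_ord_itv (n a q : nat) : (a + q <= n)%N ->
  #|[set x : 'I_n | (a <= x < a + q)%N]| = q.
Proof.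
elim: q => [|q IHq] aqn.
  by apply/eqP; rewrite cards_eq0; apply/eqP/setP => x; rewrite !inE; lia.
have lt_aq : (a + q < n)%N by rewrite addnS in aqn.
have -> : [set x : 'I_n | (a <= x < a + q.+1)%N] =
    Ordinal lt_aq |: [set x : 'I_n | (a <= x < a + q)%N].
  by apply/setP => x; rewrite !inE -val_eqE /=; lia.
by rewrite cardsU1 IHq ?(ltnW lt_aq) // inE /= ltnn andbF.
Qed.

(** The bounds in [is_ord_interval] may exceed [n] or be reversed: the upper one is cut at [n], and
    reversed bounds are replaced by an empty interval at 0. *)
Lemma ord_interval_initial (n : nat) (S : {set 'I_n}) : is_ord_interval S ->
  exists a : nat, (a + #|S| <= n)%N /\ S = [set x : 'I_n | (a <= x < a + #|S|)%N].
Proof.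
case=> a [b ->].
case: (leqP a (minn b n)) => ab.
  exists a; have -> : [set x : 'I_n | (a <= x < b)%N] =
      [set x : 'I_n | (a <= x < a + (minn b n - a))%N].
    by apply/setP => x; rewrite !inE; have := ltn_ord x; lia.
  by rewrite card_ord_itv; [split=> //; lia|lia].
exists 0%N; have -> : [set x : 'I_n | (a <= x < b)%N] = finset.set0.
  by apply/setP => x; rewrite !inE; have := ltn_ord x; lia.
by rewrite cards0; split=> //; apply/setP => x; rewrite !inE.
Qed.

Lemma leq_equitable_partition (n k : nat) (C0 : {set 'I_n}) (C : 'I_k -> {set 'I_n})
    (s : 'I_k) :
  is_perm_partition C0 C -> equitable C -> (n <= #|C0| + k * #|C s|)%N.
Proof.
case=> cov _ _ _ _ eqC; rewrite -{1}(card_ord n) -cardsT -cov.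
apply: leq_trans (leq_card_setU _ _) _; rewrite leq_add2l.
have -> : (k * #|C s| = \sum_(t < k) #|C t|)%N.
  by rewrite (eq_bigr (fun=> #|C s|)) ?sum_nat_const ?card_ord // => t _; apply: eqC.
elim/big_ind2: _ => [|A x B y lA lB|//]; first by rewrite cards0.
exact: leq_trans (leq_card_setU _ _) (leq_add lA lB).
Qed.

(** * Choice of constants, equal pieces of a class, and both outcomes of the sweep *)

Theorem theorem3 (R : realType) (m k : nat) (eps : R)
    (m_gt0 : (0 < m)%N) (eps_gt0 : 0 < eps) (eps_le : eps <= (2 * m%:R)^-1) :
  exists N : nat, forall n : nat, (N <= n)%N ->
  forall (sigma : 'S_n) (tau : 'S_m)
         (C0 : {set 'I_n}) (C : 'I_k -> {set 'I_n}) (F : 'I_k -> R -> R),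
    is_uniform_partition sigma C0 C eps F ->
    (pattern_count tau sigma)%:R < ((eps * n%:R) / (2 * k%:R * m%:R)) ^+ m ->
    forall s : 'I_k,
      exists (r : nat) (I : 'I_r -> interval R),
        [/\ (r <= m - 1)%N,
            forall i, ([set` I i] `<=` `[0, 1[)%classic,
            forall i, (lebesgue_measure [set` I i]%classic <= (6 * eps)%:E)%E,
            forall i j, i != j -> ([set` I i] `&` [set` I j] = set0)%classic
          & #|C s|%:R * (1 - 7 * m%:R * eps) <=
            #|[set y in sigma @: C s |
                `[< dilate n (\bigcup_i [set` I i])%classic
                      (y : nat)%:R >]]|%:R].
Proof.
exists (Num.bound (2 * k%:R / eps)) => n n_large sigma tau C0 C F.
move=> [partC _ eqC C0_le unif] few s.
(* If [7 * m * eps >= 1], the required lower bound is nonpositive and the empty family works. *)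
have [meps_ge1|meps_lt1] := leP 1 (7 * m%:R * eps).
  exists 0%N, (fun=> `[0, 0[); split=> // [[]//|[]//|[]//|].
  by apply: le_trans (ler0n _ _); rewrite mulr_ge0_le0 ?ler0n ?subr_le0.
have k_gt0 : (0 < k)%N := leq_ltn_trans (leq0n s) (ltn_ord s).
have k_gt0R : 0 < k%:R :> R by rewrite ltr0n.
have m_gt0R : 0 < m%:R :> R by rewrite ltr0n.
have m_ge1R : 1 <= m%:R :> R by rewrite ler1n.
have k_lt_n : 2 * k%:R < n%:R * eps.
  rewrite -ltr_pdivrMr // (lt_le_trans (archi_boundP _)) ?ler_nat //.
  by rewrite divr_ge0 ?mulr_ge0 ?ler0n // ltW.
have n_gt0R : 0 < n%:R :> R.
  by rewrite -(pmulr_lgt0 _ eps_gt0) (lt_trans _ k_lt_n) // mulr_gt0.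
have n_gt0 : (0 < n)%N by rewrite ltr0n in n_gt0R.
set c := #|C s|.
have eps_lt : 7 * eps < 1.
  have : 7 * eps * 1 <= 7 * eps * m%:R by rewrite ler_wpM2l ?mulr_ge0 // ltW.
  by lra.
(* The exceptional set has at most [eps * n < n / 7] points. With [2 * k < n * eps] this makes
   [eps * c] at least [12 / 7], which pays for all roundings below. *)
have kc_ge : 6 * n%:R <= 7 * (k%:R * c%:R) :> R.
  have : n%:R <= #|C0|%:R + k%:R * c%:R :> R.
    by rewrite -natrM -natrD ler_nat leq_equitable_partition.
  have : 7 * eps * n%:R <= 1 * n%:R by rewrite ler_wpM2r // ltW.
  by lra.
have epsc_ge : 12 <= 7 * (eps * c%:R).
  have := ler_wpM2r (ltW eps_gt0) kc_ge => kce.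
  have : k%:R * 12 <= k%:R * (7 * (eps * c%:R)) by lra.
  by rewrite ler_pM2l.
have c_ge : 12 * m%:R <= c%:R :> R.
  rewrite -(ler_pM2l eps_gt0); lra.
have c_gt0R : 0 < c%:R :> R by lra.
have c_gt0 : (0 < c)%N by rewrite ltr0n in c_gt0R.
pose q := (c %/ m)%N.
have mq_le : (m * q <= c)%N by rewrite mulnC leq_divM.
(* Rounding loses fewer than [m <= c / 12] points. *)
have mq_ge : 11 * c%:R <= 12 * (m%:R * q%:R) :> R.
  have : c%:R <= (q.+1 * m)%:R :> R by rewrite ler_nat ltnW // ltn_ceil.
  by rewrite natrM -natr1; lra.
(* The pieces are long enough for uniformity to apply to them. *)
have epsc_le_q : eps * c%:R <= q%:R.
  have : 7 * m%:R * eps * c%:R <= 1 * c%:R by rewrite ler_wpM2r ?ler0n // ltW.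
  by move=> ?; rewrite -(ler_pM2l m_gt0R); lra.
have q_gt0R : 0 < q%:R :> R by lra.
have q_gt0 : (0 < q)%N by rewrite ltr0n in q_gt0R.
have ivC : is_ord_interval (C s) by case: partC.
have [a [ac_le Ca]] := ord_interval_initial ivC.
pose J (j : 'I_m) := [set x : 'I_n | (a + j * q <= x < a + j * q + q)%N].
have jq_le (j : 'I_m) : (j * q + q <= c)%N.
  by rewrite addnC -mulSn (leq_trans _ mq_le) // leq_mul2r ltn_ord orbT.
have cardJ j : #|J j| = q.
  by apply: card_ord_itv; rewrite -addnA (leq_trans _ ac_le) // leq_add2l.
have nearC : eps_near eps (value_cdf sigma (C s)) (F s).
  by apply: unif => //; rewrite -/c ler_piMl ?ler0n //; lra.
have nearJ j : eps_near eps (value_cdf sigma (J j)) (F s).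
  apply: unif; last by rewrite cardJ.
    by exists (a + j * q)%N, (a + j * q + q)%N.
  apply/fintype.subsetP => x; rewrite Ca !inE => /andP[xlo xhi].
  rewrite (leq_trans (leq_addr _ _) xlo) (leq_trans xhi) //.
  by rewrite -addnA leq_add2l.
have M_gt0 : 0 < 5 * eps * c%:R by rewrite !mulr_gt0.
have g_ge0 : 0 <= 4 * eps by lra.
case: (slabs_or_gaps (sigma @: C s) m n_gt0 M_gt0 g_ge0 0)
    => [[l [u [l_ge0 sep dense]]]|[r [p [rm p_ge0 sep cov]]]].
  pose S (i : 'I_m) := [set x in J i |
    l (tau i) - 2 * eps <= (sigma x : nat)%:R / n%:R < u (tau i) + 2 * eps].
  have : (\prod_i #|S i| <= pattern_count tau sigma)%N.
    apply: pattern_count_ge => i j x y.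
      rewrite !inE => ij /andP[/andP[_ xi] _] /andP[/andP[jy _] _].
      apply: leq_trans xi (leq_trans _ jy).
      by rewrite -addnA leq_add2l addnC -mulSn leq_mul2r ij orbT.
    rewrite !inE => ij /andP[_ /andP[_ xi]] /andP[_ /andP[jy _]].
    have : u (tau i) + 4 * eps <= l (tau j) by apply: sep; rewrite ij ltn_ord.
    move=> lu; have : (sigma x : nat)%:R / n%:R < (sigma y : nat)%:R / n%:R :> R by lra.
    by rewrite ltr_pM2r ?invr_gt0 // ltr_nat.
  rewrite -(ler_nat R) leNgt => /negP[]; apply: lt_le_trans few _.
  rewrite natr_prod -[X in _ ^+ X]card_ord -prodr_const.
  apply: ler_prod => i _; apply/andP; split.
    by rewrite divr_ge0 ?mulr_ge0 ?ler0n // ltW.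
  have : eps * q%:R <= #|S i|%:R.
    have := @slab_density_transfer R n sigma (J i) (C s) eps (F s) _ _ n_gt0.
    rewrite cardJ => /(_ _ _ q_gt0 c_gt0 eps_gt0 (l_ge0 _ (ltn_ord (tau i)))).
    move=> /(_ _ (nearJ i) nearC (dense _ (ltn_ord (tau i)))) /le_trans; apply.
    rewrite ler_nat.
    apply: leq_trans (leq_imset_card sigma _); apply: subset_leq_card.
    apply/fintype.subsetP => y; rewrite inE => /andP[/imsetP[x Jx ->] xlu].
    by apply: imset_f; rewrite inE Jx.
  (* It remains that [n <= 2 * k * m * q], which follows from [m * q >= 11 * c / 12] and
     [k * c >= 6 * n / 7]. *)
  apply: le_trans; rewrite -mulrA ler_pM2l // ler_pdivrMr ?mulr_gt0 //.
  have := ler_wpM2l (ltW k_gt0R) mq_ge; lra.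
(* The gaps, cut at 1 to stay in [[0, 1)]; one with [p i >= 1] becomes empty. *)
exists r, (fun i : 'I_r => `[p i, Num.min (p i + 4 * eps) 1[); split.
- by rewrite subn1 -ltnS prednK.
- move=> i x /=; rewrite !in_itv /= lt_min => /andP[px /andP[_ ->]].
  by rewrite (le_trans _ px) // p_ge0.
- move=> i; rewrite lebesgue_measure_itv /= lte_fin.
  case: ifP => _; last by rewrite lee_fin; lra.
  rewrite -EFinB lee_fin; have : Num.min (p i + 4 * eps) 1 <= p i + 4 * eps.
    by rewrite ge_min lexx.
  lra.
- move=> i j; rewrite neq_ltn => ij; apply/seteqP; split=> // x [] /=.
  rewrite !in_itv /= !lt_min => /andP[pi /andP[ip _]] /andP[pj /andP[jp _]].
  case/orP: ij => ij.
    have := sep i j; rewrite ij ltn_ord => /(_ isT); lra.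
  have := sep j i; rewrite ij ltn_ord => /(_ isT); lra.
set B := [set y in _ | _].
set U := [set y in _ | _] in cov.
(* [B] is the part of the values inside the gaps, [U] the part they miss. *)
have : c%:R <= #|B|%:R + #|U|%:R :> R.
  rewrite -natrD ler_nat /c -(card_imset (C s) (@perm_inj _ sigma)).
  apply: leq_trans (leq_card_setU _ _); apply: subset_leq_card.
  apply/fintype.subsetP => y Cy; rewrite inE [y \in U]inE Cy divr_ge0 ?ler0n //=.
  case: (boolP [forall i, _]) => [_|]; first by rewrite orbT.
  rewrite negb_forall => /existsP[i]; rewrite negbK => ypi.
  rewrite orbF inE Cy /=; apply/asboolP.
  exists ((y : nat)%:R / n%:R); last by rewrite mulrC divfK ?gt_eqF.
  exists i => //=; rewrite in_itv /= lt_min; case/andP: ypi => -> -> /=.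
  by rewrite ltr_pdivrMr // mul1r ltr_nat.
(* The overshoot of 1 per slab is absorbed because [2 * eps * c >= 1]. *)
have : m%:R * (5 * eps * c%:R + 1) <= m%:R * (7 * eps * c%:R) by rewrite ler_pM2l //; lra.
lra.
Qed.
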